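(* Let $n, k \ge 3$ be integers, let $F(n,k)$ be the $(n,k)$-firecracker tree, and let $\varepsilon = 1$ if $n$ is odd and $\varepsilon = 0$ if $n$ is even. Then $$\mathrm{rn}(F(n,k)) = \frac{(n^2+\varepsilon)k}{2} + 5n - 3.$$
   Context: A $k$-star is a tree consisting of $k$ leaves and one further vertex adjacent to all of them. The $(n,k)$-firecracker tree $F(n,k)$ is obtained by taking a path with $n$ vertices (length $n-1$) and $n$ disjoint copies of a $(k-1)$-star, and identifying one leaf of the $i$-th copy with the $i$-th vertex of the path, for each $i$ (so distinct copies are attached to distinct path vertices). For a connected graph $G$, a radio labeling is a map $f: V(G) \to \{0,1,2,\ldots\}$ with $d(u,v) + |f(u)-f(v)| \ge \mathrm{diam}(G)+1$ for all distinct $u,v$; its span is $\max\{|f(u)-f(v)|\}$, and $\mathrm{rn}(G)$ is the minimum span over all radio labelings of $G$. *)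

(* Defs.v *)
From mathcomp Require Import all_boot all_order all_algebra.
From mathcomp Require Import boolp.
Set Implicit Arguments.
Unset Strict Implicit.
Unset Printing Implicit Defensive.

(* A finite graph is given by its adjacency relation e on a finType T of       *)
(* vertices.                                                                  *)
Section RadioLabeling.
Variables (T : finType) (e : rel T).

Definition has_walk (x y : T) (m : nat) : bool :=
  [exists p : m.-tuple T, path e x p && (last x p == y)].

(* The least number of edges of a walk from x to y. A shortest walk has fewer  *)
(* than #|T| edges, so searching below #|T| suffices; for x and y in different *)
(* components (excluded when the graph is connected) the value is #|T|.       *)
Definition gdist (x y : T) : nat := find (has_walk x y) (iota 0 #|T|).

Definition gdiam : nat := \max_(u : T) \max_(v : T) gdist u v.

(* `|m - n| on nat is the absolute difference, not truncated subtraction.      *)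
Definition radio_labeling (f : T -> nat) : Prop :=
  forall u v : T, u != v -> gdiam + 1 <= gdist u v + `|f u - f v|.

Definition label_span (f : T -> nat) : nat := \max_(u : T) \max_(v : T) `|f u - f v|.

Definition radio_span (s : nat) : Prop :=
  exists2 f : T -> nat, radio_labeling f & label_span f = s.

Lemma radio_span_exists : exists s, `[< radio_span s >].
Proof.
pose f (u : T) := (enum_rank u : nat) * (gdiam + 1).
exists (label_span f); apply/asboolP; exists f => // u v neq_uv.
apply: leq_trans (leq_addl _ _).
wlog lt_uv : u v neq_uv / enum_rank u < enum_rank v.
  move=> IH; have [|lt_vu|/ord_inj/enum_rank_inj eq_uv] :=
    ltngtP (enum_rank u) (enum_rank v); first exact: IH.
    by rewrite distnC; apply: IH; rewrite // eq_sym.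
  by rewrite eq_uv eqxx in neq_uv.
rewrite /f distnEr ?leq_mul2r ?(ltnW lt_uv) ?orbT //.
by rewrite -mulnBl leq_pmull // subn_gt0.
Qed.

Definition radio_number : nat := ex_minn radio_span_exists.

End RadioLabeling.

Definition path_adj (n : nat) : rel 'I_n :=
  fun i j => (i.+1 == j :> nat) || (j.+1 == i :> nat).

(* The m-star: ord0 is the centre, the m other vertices are the leaves.        *)
Definition star_adj (m : nat) : rel 'I_m.+1 :=
  fun x y => (x == ord0) != (y == ord0).

(* (i, x) is the vertex x of the i-th copy of the (k-1)-star, which has k      *)
(* vertices. The leaf ord_max of the i-th copy is the i-th vertex of the path  *)
(* (it is a leaf as soon as 2 <= k).                                          *)
Definition firecracker (n k : nat) : rel ('I_n * 'I_k.-1.+1) :=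
  fun u v =>
    (u.1 == v.1) && star_adj u.2 v.2
    || [&& u.2 == ord_max, v.2 == ord_max & path_adj u.1 v.1].

(* Main.v *)
Require Import Defs.
From mathcomp Require Import all_boot all_order all_algebra.
From mathcomp Require Import zify ring.
Set Implicit Arguments.
Unset Strict Implicit.
Unset Printing Implicit Defensive.

(* Call level of a vertex its distance to the nearest weight centre of the
   tree: the middle vertex of the path for odd [n], one of its two middle
   vertices for even [n]. With [eps = odd n], distinct vertices satisfy
     d(u, v) + eps <= level u + level v + 1,
   so consecutive vertices in increasing order of label have labels at least
   [diam + eps - level u - level v] apart. Summing over the [n * k] vertices
   gives
     rn >= (n * k - 1) * (diam + eps) + eps - 2 * (sum of the levels),
   because the levels of the first and last vertices add up to at least
   [eps]. The bound is attained by an ordering that tours the copies of the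
   star cyclically, alternating between the two sides of the path: all
   inequalities above are equalities along it. The remaining radio
   inequalities concern vertices two or three steps apart, because the label
   differences over four consecutive steps already add up to the diameter. *)

(** * Distances in graphs *)

Section GraphDistance.
Variables (T : finType) (e : rel T).

Lemma gdist_le_gdiam u v : gdist e u v <= gdiam e.
Proof. by apply: leq_trans (leq_bigmax u); apply: (leq_bigmax v). Qed.

Lemma gdist_gt0 u v : u != v -> 0 < gdist e u v.
Proof.
rewrite /gdist; have /ltn_predK <- : 0 < #|T| by apply/card_gt0P; exists u.
rewrite /=; case: ifP => // /existsP[p].
by rewrite (tuple0 p) /= => ->.
Qed.

Lemma gdistC : symmetric e -> forall u v, gdist e u v = gdist e v u.
Proof.
move=> e_sym u v; apply: eq_find => m.
suff rev_walk x y : has_walk e x y m -> has_walk e y x m.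
  by apply/idP/idP => /rev_walk.
case/existsP=> p /andP[xp /eqP <-]; apply/existsP.
have size_rev : size (rev (belast x p)) == m.
  by rewrite size_rev size_belast size_tuple.
exists (Tuple size_rev); rewrite /= rev_path (eq_path (e' := e)) ?xp /=.
  by case: (tval p) => [|w p'] //=; rewrite rev_cons last_rcons.
by move=> w z; rewrite e_sym.
Qed.

Definition is_distance (d : T -> T -> nat) : Prop :=
  [/\ forall x, d x x = 0,
      forall x w y, e x w -> d x y <= (d w y).+1
    & forall x y, x != y -> exists2 w, e x w & d x y = (d w y).+1].

Variable d : T -> T -> nat.
Hypothesis d_dist : is_distance d.

Lemma distance_le_path x p : path e x p -> d x (last x p) <= size p.
Proof.
have [d0 d_adj _] := d_dist; elim: p x => [|w p IHp] x /=; first by rewrite d0.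
by case/andP=> exw /IHp le_w; apply: leq_trans (d_adj _ _ _ exw) _.
Qed.

Lemma has_walk_distance x y : has_walk e x y (d x y).
Proof.
have [d0 _ d_descent] := d_dist; move def_m: (d x y) => m.
elim: m x def_m => [|m IHm] x def_m;
  have [eq_xy|/d_descent[w exw]] := eqVneq x y.
- by apply/existsP; exists [tuple]; rewrite /= eq_xy.
- by rewrite def_m.
- by rewrite eq_xy d0 in def_m.
rewrite def_m => -[/esym /IHm /existsP[p /andP[wp last_p]]].
by apply/existsP; exists [tuple of w :: p]; rewrite /= exw wp.
Qed.

Lemma distance_lt_card x y : d x y < #|T|.
Proof.
have /existsP[p /andP[xp /eqP <-]] := has_walk_distance x y.
case: (shortenP xp) => p' /distance_le_path le_p' uniq_p' _.
apply: leq_ltn_trans le_p' _.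
by rewrite -[X in X <= _]/(size (x :: p')) -(card_uniqP uniq_p') max_card.
Qed.

Lemma gdistE x y : gdist e x y = d x y.
Proof.
have walk_d := has_walk_distance x y; have lt_d := distance_lt_card x y.
rewrite /gdist; set lengths := iota _ _.
have has_d : has (has_walk e x y) lengths.
  by apply/hasP; exists (d x y); rewrite ?mem_iota.
apply/eqP; rewrite eqn_leq; apply/andP; split.
  rewrite leqNgt; apply/negP => /(before_find 0).
  by rewrite nth_iota // add0n walk_d.
have lt_find : find (has_walk e x y) lengths < #|T|.
  by rewrite -[X in _ < X](size_iota 0) -has_find.
have := nth_find 0 has_d; rewrite nth_iota // add0n.
case/existsP=> p /andP[xp /eqP last_p].
by have := distance_le_path xp; rewrite last_p size_tuple.
Qed.

End GraphDistance.

Section RootedProduct.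
Variables (S T : finType) (eS : rel S) (eT : rel T) (root : T).

Definition rooted_product : rel (S * T) :=
  fun u v => (u.1 == v.1) && eT u.2 v.2
    || [&& u.2 == root, v.2 == root & eS u.1 v.1].

Definition rooted_dist (dS : S -> S -> nat) (dT : T -> T -> nat)
    (u v : S * T) : nat :=
  if u.1 == v.1 then dT u.2 v.2 else dS u.1 v.1 + dT u.2 root + dT root v.2.

Lemma rooted_product_sym :
  symmetric eS -> symmetric eT -> symmetric rooted_product.
Proof.
move=> symS symT u v; rewrite /rooted_product eq_sym symT symS.
by congr (_ || _); apply: andbCA.
Qed.

Lemma is_distance_rooted_product dS dT :
  is_distance eS dS -> is_distance eT dT ->
  is_distance rooted_product (rooted_dist dS dT).
Proof.
move=> [dS0 dS_adj dS_descent] [dT0 dT_adj dT_descent]; split.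
- by move=> u; rewrite /rooted_dist eqxx.
- case=> i x [j y] [l z]; rewrite /rooted_product /rooted_dist /=.
  case/orP=> [/andP[/eqP<- exy] | /and3P[/eqP-> /eqP-> eij]].
    have := dT_adj _ _ z exy; have := dT_adj _ _ root exy.
    by case: ifP => _; lia.
  have := dS_adj _ _ l eij; rewrite dT0.
  by case: (eqVneq i l); case: (eqVneq j l) => [->|_]; rewrite ?dS0; lia.
- case=> i x [j y]; rewrite xpair_eqE /rooted_dist /=.
  have [-> neq_xy | neq_ij _] := eqVneq i j.
    have [z exz ->] := dT_descent x y neq_xy.
    by exists (j, z); rewrite /rooted_product /= eqxx ?exz.
  have [->|/dT_descent[z exz ->]] := eqVneq x root; last first.
    exists (i, z); first by rewrite /rooted_product /= eqxx exz.
    by rewrite /= (negPf neq_ij); lia.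
  have [l eil ->] := dS_descent i j neq_ij; exists (l, root).
    by rewrite /rooted_product /= !eqxx eil orbT.
  by rewrite dT0 /=; case: eqVneq => [->|_]; rewrite ?dS0; lia.
Qed.

End RootedProduct.

Definition path_dist n (i j : 'I_n) : nat := `|i - j|.

Lemma path_adj_sym n : symmetric (@path_adj n).
Proof. by move=> i j; rewrite /path_adj orbC. Qed.

Lemma is_distance_path n : is_distance (@path_adj n) (@path_dist n).
Proof.
rewrite /path_dist; split=> [i | i j l | i j].
- by rewrite distnn.
- by rewrite /path_adj; lia.
rewrite -val_eqE /= neq_ltn => /orP[lt_ij | lt_ji].
  have lt_n : i.+1 < n by apply: leq_ltn_trans (ltn_ord j).
  by exists (Ordinal lt_n); rewrite /path_adj /=; lia.
have lt_n : i.-1 < n by apply: leq_ltn_trans (leq_pred _) (ltn_ord i).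
by exists (Ordinal lt_n); rewrite /path_adj /=; lia.
Qed.

Definition star_dist m (x y : 'I_m.+1) : nat :=
  if x == y then 0 else if (x == ord0) || (y == ord0) then 1 else 2.

Lemma star_adj_sym m : symmetric (@star_adj m).
Proof. by move=> x y; rewrite /star_adj eq_sym. Qed.

Lemma star_distC m (x y : 'I_m.+1) : star_dist x y = star_dist y x.
Proof. by rewrite /star_dist eq_sym orbC. Qed.

Lemma star_dist_triangle m (x y z : 'I_m.+1) :
  star_dist x z <= star_dist x y + star_dist y z.
Proof. by rewrite /star_dist -!val_eqE /=; repeat case: eqP => //=; lia. Qed.

Lemma star_dist_detour m (x y z : 'I_m.+1) : x != z ->
  star_dist x y + star_dist y z <= star_dist x z + 2.
Proof. by rewrite /star_dist -!val_eqE /=; repeat case: eqP => //=; lia. Qed.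

Lemma sum_star_dist m (y : 'I_m.+1) : y != ord0 ->
  \sum_x star_dist x y + 1 = 2 * m.
Proof.
case: (unliftP ord0 y) => [j ->|->]; last by rewrite eqxx.
move=> _; have m_gt0 : 0 < m by apply: leq_ltn_trans (ltn_ord j).
have other_leaf i : i != j -> star_dist (lift ord0 i) (lift ord0 j) = 2.
  by move=> neq_ij; rewrite /star_dist (inj_eq lift_inj) (negPf neq_ij).
rewrite big_ord_recl (bigD1 j) //= (eq_bigr _ other_leaf).
by rewrite (sum_nat_const (predC1 j)) cardC1 card_ord /star_dist /= eqxx; lia.
Qed.

Lemma is_distance_star m : is_distance (@star_adj m) (@star_dist m).
Proof.
rewrite /star_adj /star_dist; split=> [x | x w y | x y neq_xy].
- by rewrite eqxx.
- have [->|_] := eqVneq x ord0; have [->|_] := eqVneq w ord0 => //= _.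
    by rewrite eq_sym; do 3?case: ifP.
  by case: ifP => // _; rewrite eq_sym; case: ifP.
- have [x0|_] := eqVneq x ord0.
    exists y; last by rewrite (negPf neq_xy) eqxx.
    by rewrite -x0 [y == x]eq_sym (negPf neq_xy).
  exists ord0; first by rewrite eqxx.
  by rewrite (negPf neq_xy) [ord0 == y]eq_sym eqxx /=; case: ifP.
Qed.

(** * Radio numbers and vertex orderings *)

Section RadioNumber.
Variables (T : finType) (e : rel T).

Lemma leq_radio_number b :
  (forall f, radio_labeling e f -> b <= label_span f) -> b <= radio_number e.
Proof.
move=> b_le; rewrite /radio_number.
case: ex_minnP => m /boolp.asboolP[f rad_f <-] _.
exact: b_le.
Qed.

Lemma radio_number_le f : radio_labeling e f -> radio_number e <= label_span f.
Proof.
move=> rad_f; rewrite /radio_number; case: ex_minnP => m _; apply.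
by apply/boolp.asboolP; exists f.
Qed.

Lemma leq_label_span (f : T -> nat) u v : f v <= f u + label_span f.
Proof.
have: `|f u - f v| <= label_span f.
  by apply: leq_trans (leq_bigmax u); apply: (leq_bigmax v).
by lia.
Qed.

Section LowerBound.
Variables (level : T -> nat) (eps : nat).
Hypothesis gdist_level :
  forall u v, u != v -> gdist e u v + eps <= level u + level v + 1.

Lemma label_path_bound f x p :
    radio_labeling e f -> path (relpre f leq) x p -> uniq (x :: p) ->
  size p * (gdiam e + eps) + level x + level (last x p) + f x
    <= f (last x p) + 2 * \sum_(u <- x :: p) level u.
Proof.
move=> rad_f; elim: p x => [|y p IHp] x; first by rewrite big_seq1 /=; lia.
rewrite big_cons /= inE negb_or -andbA => /andP[le_xy /IHp{}IHp].
case/and3P=> neq_xy _ /IHp.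
have := rad_f x y neq_xy; have := gdist_level neq_xy.
by rewrite mulSn mulnDr; move: le_xy; lia.
Qed.

Lemma radio_number_lower_bound : 1 < #|T| ->
  #|T|.-1 * (gdiam e + eps) + eps <= radio_number e + 2 * \sum_u level u.
Proof.
move=> T_gt1; rewrite [X in _ <= X]addnC -leq_subLR.
apply: leq_radio_number => f rad_f; rewrite leq_subLR [X in _ <= X]addnC.
pose r : rel T := relpre f leq; pose s := sort r (enum T).
have size_s : size s = #|T| by rewrite size_sort -cardE.
have uniq_s : uniq s by rewrite sort_uniq enum_uniq.
have sorted_s : sorted r s by apply: sort_sorted => x y; apply: leq_total.
have <- : \sum_(u <- s) level u = \sum_u level u.
  by rewrite -big_enum; apply: perm_big; rewrite perm_sort.
case: s size_s uniq_s sorted_s => [|x [|y p]] size_s;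
  try by rewrite -size_s in T_gt1.
rewrite -size_s => uniq_s /(label_path_bound rad_f)/(_ uniq_s).
rewrite [last _ _]/=; set z := last y p.
have neq_xz : x != z.
  by apply: contraTneq uniq_s => ->; rewrite cons_uniq mem_last.
have := gdist_gt0 e neq_xz; have := gdist_level neq_xz.
have := leq_label_span f x z.
by rewrite /=; lia.
Qed.

End LowerBound.

Definition gap (u v : T) : nat := gdiam e + 1 - gdist e u v.

Lemma gap_add_gdist u v : gap u v + gdist e u v = gdiam e + 1.
Proof. by rewrite /gap subnK // addn1 leqW // gdist_le_gdiam. Qed.

Definition radio_ordering (s : nat -> T) : Prop :=
  {in gtn #|T| &, injective s} /\
  forall i j, i < j < #|T| ->
    gdiam e + 1 <= gdist e (s i) (s j) + \sum_(i <= l < j) gap (s l) (s l.+1).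

(* Since distinct vertices are at distance at least 1, an interval whose gaps
   add up to the diameter needs no further check. *)
Lemma short_radio_ordering q s :
    {in gtn #|T| &, injective s} ->
    (forall i d, 0 < d < q -> i + d < #|T| ->
      gdiam e + 1
        <= gdist e (s i) (s (i + d))
           + \sum_(i <= l < i + d) gap (s l) (s l.+1)) ->
    (forall i, i + q < #|T| ->
      gdiam e <= \sum_(i <= l < i + q) gap (s l) (s l.+1)) ->
  radio_ordering s.
Proof.
move=> s_inj short long; split=> // i j /andP[lt_ij lt_j].
have [lt_q | le_q] := ltnP (j - i) q.
  have := short i (j - i); rewrite subn_gt0 lt_ij lt_q (subnKC (ltnW lt_ij)).
  by apply.
have neq_s : s i != s j.
  have lt_i := ltn_trans lt_ij lt_j.
  by apply: contraTneq lt_ij => eq_s; rewrite (s_inj i j) ?ltnn.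
have le_iq : i + q <= j by lia.
rewrite (big_cat_nat _ le_iq) ?leq_addr //=.
by have := long i; have := gdist_gt0 e neq_s; lia.
Qed.

Section UpperBound.
Variable s : nat -> T.
Hypotheses (e_sym : symmetric e) (rad_s : radio_ordering s).

Let vertices : seq T := mkseq s #|T|.

Lemma radio_ordering_perm : perm_eq vertices (enum T).
Proof.
have uniq_v : uniq vertices by apply/mkseq_uniqP; case: rad_s.
apply: uniq_perm (enum_uniq _) _ => //.
have sub_v : {subset vertices <= enum T} by move=> u _; rewrite mem_enum.
have [|_ //] := uniq_min_size uniq_v sub_v.
by rewrite size_mkseq -cardE.
Qed.

Lemma sum_radio_ordering (F : T -> nat) :
  \sum_(0 <= i < #|T|) F (s i) = \sum_u F u.
Proof.
rewrite -big_enum -(perm_big _ radio_ordering_perm) big_map.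
by rewrite /index_iota subn0.
Qed.

Lemma radio_number_le_gaps :
  radio_number e <= \sum_(0 <= l < #|T|.-1) gap (s l) (s l.+1).
Proof.
pose label t := \sum_(0 <= l < t) gap (s l) (s l.+1).
have label_window i j : i <= j ->
    label j = label i + \sum_(i <= l < j) gap (s l) (s l.+1).
  by move=> le_ij; rewrite /label (big_cat_nat _ le_ij).
pose pos u := index u vertices.
have mem_vertices u : u \in vertices.
  by rewrite (perm_mem radio_ordering_perm) mem_enum.
have pos_lt u : pos u < #|T| by rewrite -[X in _ < X](size_mkseq s) index_mem.
have posK : cancel pos s.
  by move=> u; rewrite -[RHS](nth_index u (mem_vertices u)) nth_mkseq ?pos_lt.
have lt_radio u v : pos u < pos v ->
    gdiam e + 1 + label (pos u) <= gdist e u v + label (pos v).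
  move=> lt_uv; have [_ rad_ij] := rad_s; have := rad_ij (pos u) (pos v).
  by rewrite lt_uv pos_lt !posK (label_window _ _ (ltnW lt_uv)); lia.
have rad_label : radio_labeling e (label \o pos).
  move=> u v neq_uv; have neq_pos : pos u != pos v by rewrite (can_eq posK).
  case: (ltngtP (pos u) (pos v)) neq_pos => // /lt_radio /=; first by lia.
  by rewrite gdistC //; lia.
apply: leq_trans (radio_number_le rad_label) _.
apply/bigmax_leqP => u _; apply/bigmax_leqP => v _ /=.
have label_le w : label (pos w) <= label #|T|.-1.
  have le_last : pos w <= #|T|.-1 by rewrite -ltnS (ltn_predK (pos_lt w)).
  by rewrite (label_window _ _ le_last) leq_addr.
have := label_le u; have := label_le v; rewrite -/(label _).
move: (label (pos u)) (label (pos v)) (label #|T|.-1) => label_u label_v span.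
by lia.
Qed.

End UpperBound.

(* An ordering meeting the lower bound: every inequality summed in
   [radio_number_lower_bound] is an equality along it. *)
Lemma radio_number_tight (level : T -> nat) eps s :
    1 < #|T| -> symmetric e -> radio_ordering s ->
    (forall u v, u != v -> gdist e u v + eps <= level u + level v + 1) ->
    (forall i, i.+1 < #|T| ->
      gdist e (s i) (s i.+1) + eps = level (s i) + level (s i.+1) + 1) ->
    level (s 0) + level (s #|T|.-1) = eps ->
  radio_number e + 2 * \sum_u level u = #|T|.-1 * (gdiam e + eps) + eps.
Proof.
move=> T_gt1 e_sym rad_s gdist_level tight ends.
have lower := radio_number_lower_bound gdist_level T_gt1.
suff sum_gap t : t < #|T| ->
    \sum_(0 <= l < t) gap (s l) (s l.+1) + 2 * \sum_(0 <= l < t.+1) level (s l)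
      = t * (gdiam e + eps) + level (s 0) + level (s t).
  have T_pred : #|T|.-1.+1 = #|T| by apply: ltn_predK T_gt1.
  have := sum_gap #|T|.-1; rewrite T_pred leqnn (sum_radio_ordering rad_s).
  move=> /(_ isT).
  by have := radio_number_le_gaps e_sym rad_s; lia.
elim: t => [_|t IHt lt_t]; first by rewrite big_geq // big_nat1; lia.
rewrite (big_nat_recr t) // (big_nat_recr t.+1) // (mulSn t) /=.
have := IHt (ltnW lt_t); have := tight t lt_t.
have := gap_add_gdist (s t) (s t.+1).
by lia.
Qed.

End RadioNumber.

(** * Firecrackers *)

Section Firecracker.
Variables n k : nat.
Notation vertex := ('I_n * 'I_k.-1.+1)%type.
Notation gdist := (gdist (@firecracker n k)).

Definition depth (x : 'I_k.-1.+1) : nat := star_dist x ord_max.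

Lemma depth_ord0 : 1 < k -> depth ord0 = 1.
Proof.
by move=> k_gt1; rewrite /depth /star_dist -val_eqE /=; case: eqP; lia.
Qed.

Lemma depth_ord_max : depth ord_max = 0.
Proof. by rewrite /depth /star_dist eqxx. Qed.

Lemma depth_le2 (x : 'I_k.-1.+1) : depth x <= 2.
Proof. by rewrite /depth /star_dist; do 2?case: ifP. Qed.

Lemma firecracker_sym : symmetric (@firecracker n k).
Proof. exact: rooted_product_sym (@path_adj_sym n) (@star_adj_sym _). Qed.

Lemma firecracker_gdist (u v : vertex) :
  gdist u v = if u.1 == v.1 then star_dist u.2 v.2
              else `|u.1 - v.1| + depth u.2 + depth v.2.
Proof.
rewrite (gdistE (is_distance_rooted_product ord_max (@is_distance_path n)
                   (@is_distance_star k.-1))).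
by rewrite /rooted_dist [star_dist ord_max _]star_distC.
Qed.

Lemma firecracker_gdist_le (u v : vertex) :
  gdist u v <= `|u.1 - v.1| + depth u.2 + depth v.2.
Proof.
rewrite firecracker_gdist; case: eqP => // _.
rewrite /depth [star_dist v.2 _]star_distC -addnA.
exact: leq_trans (star_dist_triangle _ _ _) (leq_addl _ _).
Qed.

Lemma firecracker_gdist_ge (u v : vertex) : u != v ->
  `|u.1 - v.1| + depth u.2 + depth v.2 <= gdist u v + (u.1 == v.1).*2.
Proof.
rewrite firecracker_gdist; case: u v => [i x] [j y]; rewrite xpair_eqE /=.
case: eqVneq => [->|_ _] /=; last by rewrite addn0.
by rewrite distnn /depth [star_dist y _]star_distC; apply: star_dist_detour.
Qed.

Lemma firecracker_gdiam : 1 < n -> 2 < k -> gdiam (@firecracker n k) = n + 3.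
Proof.
move=> n_gt1 k_gt2; apply/eqP; rewrite eqn_leq; apply/andP; split.
  suff gdist_le (u v : vertex) : gdist u v <= n + 3.
    by apply/bigmax_leqP => u _; apply/bigmax_leqP => v _.
  have := firecracker_gdist_le u v; have := ltn_ord u.1; have := ltn_ord v.1.
  by have := depth_le2 u.2; have := depth_le2 v.2; lia.
have n_gt0 := ltnW n_gt1; have leaf_lt : 1 < k.-1.+1 by lia.
have last_lt : n.-1 < n by rewrite prednK.
pose u : vertex := (Ordinal n_gt0, Ordinal leaf_lt).
pose v : vertex := (Ordinal last_lt, Ordinal leaf_lt).
apply: leq_trans (gdist_le_gdiam _ u v); rewrite firecracker_gdist.
rewrite /depth /star_dist -!val_eqE /=.
by repeat case: eqP => //=; lia.
Qed.

(* The distance from the path vertex [i] to the nearer of the weight centres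
   [n.-1./2] and [n./2], which coincide for odd [n]; at most one of the two
   truncated subtractions is nonzero. *)
Definition center_dist (i : nat) : nat := (n.-1./2 - i) + (i - n./2).

Definition level (u : vertex) : nat := center_dist u.1 + depth u.2.

Lemma double_sum_subn h p : 2 * \sum_(i < h + p) (h - i) = h * h.+1.
Proof.
elim: h => [|h IHh]; first by rewrite big1.
rewrite addSn big_ord_recl /=; under eq_bigr do rewrite subSS.
by rewrite mulnDr IHh; lia.
Qed.

Lemma sum_center_dist : \sum_(i < n) center_dist i = n.-1./2 * n.-1./2.+1.
Proof.
case: (posnP n) => [-> | n_gt0]; first by rewrite big_ord0.
have n_eq : n = n.-1./2 + n./2.+1 by lia.
rewrite -(double_sum_subn _ n./2.+1) -n_eq mul2n -addnn big_split /=.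
congr (_ + _); rewrite (reindex_inj rev_ord_inj) /=; apply: eq_bigr => i _.
by have := ltn_ord i; lia.
Qed.

Lemma sum_level : 1 < k ->
  \sum_u level u + 3 * n = k * (n.-1./2 * n.-1./2.+1) + 2 * (n * k).
Proof.
move=> k_gt1; have k_eq : k.-1.+1 = k by lia.
have leaf_max : ord_max != ord0 :> 'I_k.-1.+1 by rewrite -val_eqE /=; lia.
have sum_depth : \sum_(x < k.-1.+1) depth x + 1 = 2 * k.-1.
  exact: sum_star_dist.
rewrite -(pair_bigA _ (fun i x => center_dist (i : 'I_n) + depth x)).
under eq_bigr do rewrite big_split sum_nat_const card_ord /=.
rewrite big_split -big_distrr sum_center_dist sum_nat_const card_ord /= {1}k_eq.
rewrite -addnA; congr (_ + _).
rewrite [3 * n]mulnC -mulnDr mulnCA; congr (_ * _).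
have -> : 2 * k = 2 * k.-1 + 2 by lia.
by rewrite -sum_depth -addnA.
Qed.

Lemma firecracker_gdist_level (u v : vertex) :
  gdist u v + odd n <= level u + level v + 1.
Proof.
have := firecracker_gdist_le u v; have := ltn_ord u.1; have := ltn_ord v.1.
by rewrite /level /center_dist; lia.
Qed.

(** * An ordering attaining the lower bound *)

(* A tour visits the copies [n./2], [0], [n./2.+1], [1], ..., and starts
   again. *)
Definition tour (j : nat) : nat := j./2 + (if odd j then 0 else n./2).

Lemma tour_lt j : j < n -> tour j < n.
Proof. by rewrite /tour; case: ifP; lia. Qed.

Lemma tour_inj : {in gtn n &, injective tour}.
Proof. by move=> i j; rewrite !inE /tour; do 2?case: ifP; lia. Qed.

(* The last alternative is the return from the end of a tour to its start,
   for even [n]. *)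
Definition crossing (i j : nat) : Prop :=
  [\/ j = i + n./2.+1, i = j + n./2 | [/\ ~~ odd n, i.+1 = n./2 & j = n./2]].

Lemma crossing_tour j : j < n -> crossing (tour j) (tour (j.+1 %% n)).
Proof.
rewrite leq_eqVlt => /predU1P[eq_n|lt_n].
  rewrite eq_n modnn /crossing /tour /=.
  case: ifP => odd_j; last by constructor 2; lia.
  by constructor 3; split; lia.
rewrite modn_small // /crossing /tour /=.
by case: (boolP (odd j)) => odd_j; [constructor 1 | constructor 2] => /=; lia.
Qed.

(* The second alternative is the one step of the ordering for odd [n] that
   skips the middle copy. It must avoid vertices of depth 2, for which the
   radio inequality between their two neighbours in the ordering fails. *)
Definition tour_step (u v : vertex) : Prop :=
  crossing u.1 v.1 \/
  [/\ odd n, u.1.+1 = n, v.1 = 0 :> nat, u.2 = ord0 & v.2 = ord_max].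

Section Ordering.
Hypotheses (n_gt2 : 2 < n) (k_gt2 : 2 < k).
Notation gap := (gap (@firecracker n k)).

Let diam_eq : gdiam (@firecracker n k) = n + 3.
Proof. exact: firecracker_gdiam (ltnW n_gt2) k_gt2. Qed.

Lemma tour_step_cases (u v : vertex) : tour_step u v ->
  [\/ v.1 = u.1 + n./2.+1 :> nat,
      u.1 = v.1 + n./2 :> nat,
      ~~ odd n /\ u.1.+1 = n./2 /\ v.1 = n./2 :> nat |
      odd n /\ u.1.+1 = n /\ v.1 = 0 :> nat /\ depth u.2 = 1 /\ depth v.2 = 0].
Proof.
case=> [[? | ? | [? ? ?]] | [? ? ? -> ->]].
- by constructor 1.
- by constructor 2.
- by constructor 3.
by constructor 4; rewrite depth_ord0 ?depth_ord_max ?(ltnW k_gt2).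
Qed.

Lemma gdist_tour_step (u v : vertex) :
  tour_step u v -> gdist u v = `|u.1 - v.1| + depth u.2 + depth v.2.
Proof.
move=> /tour_step_cases step; rewrite firecracker_gdist -val_eqE /=.
by case: eqP => //; case: step; lia.
Qed.

Lemma level_tour_step (u v : vertex) :
  tour_step u v -> gdist u v + odd n = level u + level v + 1.
Proof.
move=> step; rewrite gdist_tour_step // /level /center_dist.
have := ltn_ord u.1; have := ltn_ord v.1.
by case: (tour_step_cases step); lia.
Qed.

Lemma tour_step_gap (u v : vertex) : tour_step u v ->
  [\/ v.1 = u.1 + n./2.+1 :> nat
        /\ gap u v + depth u.2 + depth v.2 + n./2 = n + 3,
      u.1 = v.1 + n./2 :> nat
        /\ gap u v + depth u.2 + depth v.2 + n./2 = n + 4,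
      ~~ odd n /\ u.1.+1 = n./2 /\ v.1 = n./2 :> nat
        /\ gap u v + depth u.2 + depth v.2 = n + 3 |
      odd n /\ u.1.+1 = n /\ v.1 = 0 :> nat
        /\ depth u.2 = 1 /\ depth v.2 = 0 /\ gap u v = 4].
Proof.
move=> step; have := gap_add_gdist (@firecracker n k) u v.
rewrite diam_eq (gdist_tour_step step).
have := ltn_ord u.1; have := ltn_ord v.1.
by case: (tour_step_cases step) => ?;
  [constructor 1 | constructor 2 | constructor 3 | constructor 4]; lia.
Qed.

(* With the kinds of the steps fixed, the claims below are linear in the
   copies and depths involved. *)
Lemma radio_two_steps (u v w : vertex) :
    u != w -> tour_step u v -> tour_step v w ->
  n + 3 < gdist u w + (gap u v + gap v w).
Proof.
move=> neq_uw /tour_step_gap uv /tour_step_gap vw.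
have := firecracker_gdist_ge neq_uw.
have := gdist_gt0 (@firecracker n k) neq_uw.
have := depth_le2 u.2; have := depth_le2 v.2; have := depth_le2 w.2.
have := ltn_ord u.1; have := ltn_ord v.1; have := ltn_ord w.1.
by rewrite -val_eqE /=; case: uv => ?; case: vw; case: eqP; lia.
Qed.

Lemma radio_three_steps (u v w x : vertex) :
    u != x -> tour_step u v -> tour_step v w -> tour_step w x ->
  n + 3 < gdist u x + (gap u v + gap v w + gap w x).
Proof.
move=> neq_ux /tour_step_gap uv /tour_step_gap vw /tour_step_gap wx.
have := firecracker_gdist_ge neq_ux.
have := gdist_gt0 (@firecracker n k) neq_ux.
have := depth_le2 u.2; have := depth_le2 v.2.
have := depth_le2 w.2; have := depth_le2 x.2.
have := ltn_ord u.1; have := ltn_ord v.1.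
have := ltn_ord w.1; have := ltn_ord x.1.
by rewrite -val_eqE /=; case: uv => ?; case: vw => ?; case: wx; case: eqP; lia.
Qed.

Lemma gap_four_steps (u v w x y : vertex) :
    tour_step u v -> tour_step v w -> tour_step w x -> tour_step x y ->
  n + 3 <= gap u v + gap v w + gap w x + gap x y.
Proof.
move=> /tour_step_gap uv /tour_step_gap vw /tour_step_gap wx /tour_step_gap xy.
have := depth_le2 u.2; have := depth_le2 v.2; have := depth_le2 w.2.
have := depth_le2 x.2; have := depth_le2 y.2.
have := ltn_ord u.1; have := ltn_ord v.1; have := ltn_ord w.1.
have := ltn_ord x.1; have := ltn_ord y.1.
by case: uv => ?; case: vw => ?; case: wx => ?; case: xy; lia.
Qed.

Let n_gt0 : 0 < n. Proof. exact: ltn_trans n_gt2. Qed.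

Definition tour_copy (r j : nat) : nat :=
  tour ((j + (odd n && (r == k.-1))) %% n).

Lemma tour_copy_lt r j : tour_copy r j < n.
Proof. exact/tour_lt/ltn_pmod. Qed.

(* The middle copy goes from its path vertex [k.-1] down to its star centre
   [0]; the other copies start at [k.-2] and end with their path vertex. *)
Definition star_index (r c : nat) : nat :=
  if c == n./2 then k.-1 - r else if r == k.-1 then k.-1 else k.-2 - r.

Lemma star_index_lt r c : star_index r c < k.-1.+1.
Proof. by rewrite /star_index; do 2?case: ifP; lia. Qed.

Lemma star_index_inj c : {in gtn k &, injective (star_index^~ c)}.
Proof. by move=> r r'; rewrite !inE /star_index; repeat case: ifP; lia. Qed.

(* The vertex visited at step [j] of round [r]; each round visits every copy
   once. For odd [n] the last round starts one step late, so that the middle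
   copy comes last. The ordering starts at a weight centre, and it ends at
   the other one or, for odd [n], at the star centre of the middle copy. *)
Definition visit (r j : nat) : vertex :=
  (Ordinal (tour_copy_lt r j), inord (star_index r (tour_copy r j))).

Lemma visit_star r j : (visit r j).2 = star_index r (tour_copy r j) :> nat.
Proof. exact: inordK (star_index_lt _ _). Qed.

Lemma visit_inj r r' j j' : r < k -> r' < k -> j < n -> j' < n ->
  visit r j = visit r' j' -> r = r' /\ j = j'.
Proof.
move=> lt_r lt_r' lt_j lt_j' eq_v.
have eq_copy : tour_copy r j = tour_copy r' j' by have [] := eq_v.
have eq_r : r = r'.
  apply: (@star_index_inj (tour_copy r j)); rewrite ?inE //.
  by rewrite -visit_star eq_v visit_star eq_copy.
split=> //; have /eqP := tour_inj (ltn_pmod _ n_gt0) (ltn_pmod _ n_gt0) eq_copy.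
by rewrite eq_r eqn_modDr !modn_small // => /eqP.
Qed.

Lemma visit_within_round r j : tour_step (visit r j) (visit r j.+1).
Proof.
left; rewrite /= /tour_copy addSn -[(j + _).+1]addn1 -(modnDml _ 1) addn1.
exact/crossing_tour/ltn_pmod.
Qed.

Lemma visit_next_round r : r.+1 < k -> tour_step (visit r n.-1) (visit r.+1 0).
Proof.
move=> lt_r; have early : (r == k.-1) = false by lia.
have copy_r : tour_copy r n.-1 = tour n.-1.
  by rewrite /tour_copy early andbF addn0 modn_small ?prednK.
have [/andP[odd_n /eqP last_r] | not_last] :=
  boolP (odd n && (r.+1 == k.-1)); last first.
  left; rewrite /= copy_r /tour_copy (negPf not_last) addn0.
  by have := @crossing_tour n.-1; rewrite prednK // modnn mod0n; apply.
have copy_r1 : tour_copy r.+1 0 = 0.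
  by rewrite /tour_copy odd_n last_r eqxx modn_small ?(ltnW n_gt2).
have tour_last : tour n.-1 = n.-1 by rewrite /tour; case: ifP; lia.
right; split=> //.
- by rewrite /= copy_r tour_last prednK.
- apply: ord_inj; rewrite visit_star copy_r tour_last /star_index early.
  by case: eqP => /=; lia.
- apply: ord_inj; rewrite visit_star copy_r1 /star_index last_r eqxx.
  by case: eqP => /=; lia.
Qed.

Definition firecracker_order (t : nat) : vertex := visit (t %/ n) (t %% n).

Lemma firecracker_order_inj : {in gtn (n * k) &, injective firecracker_order}.
Proof.
move=> t t'; rewrite !inE mulnC => lt_t lt_t' eq_v.
rewrite (divn_eq t n) (divn_eq t' n).
by have [||||-> ->] := visit_inj _ _ _ _ eq_v; rewrite ?ltn_divLR ?ltn_pmod.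
Qed.

Lemma firecracker_order_step t :
  t.+1 < n * k -> tour_step (firecracker_order t) (firecracker_order t.+1).
Proof.
move=> lt_t; rewrite /firecracker_order modnS.
case: ifP => [n_dvd | not_dvd]; last first.
  by rewrite divnS // not_dvd; apply: visit_within_round.
have next_r : t.+1 %/ n = (t %/ n).+1 by rewrite divnS // n_dvd.
have -> : t %% n = n.-1.
  by have := divn_eq t n; have := divnK n_dvd; rewrite next_r mulSn; lia.
by rewrite next_r; apply: visit_next_round; rewrite -next_r ltn_divLR // mulnC.
Qed.

Lemma level_visit_first : level (visit 0 0) = 0.
Proof.
have copy_mid : tour_copy 0 0 = n./2.
  rewrite /tour_copy; have -> : (0 == k.-1) = false by lia.
  by rewrite andbF mod0n.
have star_path : (visit 0 0).2 = ord_max.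
  by apply: ord_inj; rewrite visit_star copy_mid /star_index eqxx subn0.
by rewrite /level star_path depth_ord_max /= copy_mid /center_dist; lia.
Qed.

Lemma level_visit_last : level (visit k.-1 n.-1) = odd n.
Proof.
have copy_last : tour_copy k.-1 n.-1 = n.-1./2.
  rewrite /tour_copy eqxx andbT; case: (boolP (odd n)) => odd_n.
    by rewrite addn1 prednK // modnn /tour /=; lia.
  by rewrite addn0 modn_small ?prednK // /tour; case: ifP; lia.
have star_last : (visit k.-1 n.-1).2 = if odd n then ord0 else ord_max.
  apply: ord_inj; rewrite visit_star copy_last /star_index eqxx subnn.
  have -> : (n.-1./2 == n./2) = odd n by lia.
  by case: (odd n).
rewrite /level star_last /= copy_last.
have -> : center_dist n.-1./2 = 0 by rewrite /center_dist; lia.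
by case: (odd n); rewrite ?depth_ord_max ?depth_ord0 ?(ltnW k_gt2).
Qed.

Lemma firecracker_order_ends :
  level (firecracker_order 0) + level (firecracker_order (n * k).-1) = odd n.
Proof.
have -> : (n * k).-1 = k.-1 * n + n.-1.
  by case: k k_gt2 => // m _; rewrite mulnC mulSn; lia.
rewrite /firecracker_order div0n mod0n level_visit_first divnMDl // modnMDl.
by rewrite divn_small ?modn_small ?prednK // addn0 level_visit_last.
Qed.

Lemma card_firecracker : #|{: vertex}| = n * k.
Proof. by rewrite card_prod !card_ord prednK //; apply: ltn_trans k_gt2. Qed.

Lemma firecracker_radio_ordering :
  radio_ordering (@firecracker n k) firecracker_order.
Proof.
have step := firecracker_order_step; have order_inj := firecracker_order_inj.
apply: (short_radio_ordering (q := 4)) => [|i d|i]; rewrite card_firecracker //.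
  rewrite diam_eq addn1 => d_range lt_id.
  have neq_id : firecracker_order i != firecracker_order (i + d).
    by apply/eqP => /order_inj; rewrite !inE; lia.
  case: d d_range lt_id neq_id => [|[|[|[|d]]]] // _;
    rewrite ?addn1 ?(addn2 i) ?(addn3 i) => lt_id neq_id;
    rewrite !(@big_nat_recr _ _ _ _ i) ?leqW //= big_geq // add0n.
  - by rewrite [X in _ <= X]addnC gap_add_gdist diam_eq addn1.
  - by apply: radio_two_steps => //; apply: step; lia.
  - by apply: radio_three_steps => //; apply: step; lia.
rewrite diam_eq addn4 => lt_i4.
rewrite !(@big_nat_recr _ _ _ _ i) ?leqW //= big_geq // add0n.
by apply: gap_four_steps; apply: step; lia.
Qed.

End Ordering.

End Firecracker.

Lemma radio_number_firecracker_level n k : 2 < n -> 2 < k ->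
  radio_number (@firecracker n k) + 2 * \sum_u @level n k u
    = (n * k).-1 * (n + 3 + odd n) + odd n.
Proof.
move=> n_gt2 k_gt2; have n_gt1 := ltnW n_gt2.
have card_nk := @card_firecracker n k k_gt2.
rewrite -(firecracker_gdiam n_gt1 k_gt2) -card_nk.
apply: (radio_number_tight (s := firecracker_order k n_gt2)).
- by rewrite card_nk (leq_trans n_gt1) // leq_pmulr // 2?ltnW.
- exact: firecracker_sym.
- exact: firecracker_radio_ordering.
- by move=> u v _; apply: firecracker_gdist_level.
- move=> t lt_t; apply/level_tour_step/firecracker_order_step => //.
  by rewrite -card_nk.
- by rewrite card_nk; apply: firecracker_order_ends.
Qed.

Lemma radio_number_firecracker n k : 2 < n -> 2 < k ->
  2 * (radio_number (@firecracker n k) + 3) = (n ^ 2 + odd n) * k + 10 * n.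
Proof.
move=> n_gt2 k_gt2; have n_gt0 : 0 < n by lia.
have weight := sum_level n (ltnW k_gt2).
have bound := radio_number_firecracker_level n_gt2 k_gt2.
have count :
    (n * k).-1 * (n + 3 + odd n) + (n + 3 + odd n) = n * k * (n + 3 + odd n).
  by rewrite addnC -mulSn prednK // muln_gt0 n_gt0 2?ltnW.
have n_eq : n = 2 * n.-1./2 + 1 + ~~ odd n by lia.
move: (radio_number _) (\sum_u _) (_.-1 * _) (n.-1./2) bound weight count n_eq.
move=> rn total gaps h; case: (odd n) => /= bound weight count n_eq;
  by rewrite n_eq in bound weight count *; lia.
Qed.

Import GRing.Theory.
Local Open Scope ring_scope.

Theorem theorem4p2 (n k : nat) (hn : (3 <= n)%N) (hk : (3 <= k)%N) :
  (radio_number (@firecracker n k))%:R =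
    (n%:R ^+ 2 + (if odd n then 1 else 0)) * k%:R / 2 + 5 * n%:R - 3 :> rat.
Proof.
have /(congr1 (fun m => m%:R : rat)) := radio_number_firecracker hn hk.
rewrite !natrM !natrD !natrM natrD natrX.
have -> : (odd n)%:R = (if odd n then 1 else 0) :> rat by case: (odd n).
move: (radio_number _)%:R (if _ then _ else _) => r o eq_r.
have -> : r = (2 * (r + 3)) / 2 - 3 :> rat by field.
by rewrite eq_r; field.
Qed.
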